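(* Let $(X,d,\mu)$ be a locally compact metric measured space, with $\mu$ a Radon measure, of finite volume entropy $h$. Assume that a second countable locally compact group $G$ acts on $X$ by measure-preserving isometries. If $X$ has a $G$-equivariant tangent bundle $TX$ with curvature at most $\kappa$, where $\kappa<0$, then for any $p>1$ with $p>\frac{h}{|\kappa|}$, the group $G$ admits an affine isometric action on $L^p(X,TX)$, which is proper when the tangent bundle $TX$ is proper.
   Context: Volume entropy: $h=\limsup_{r\to\infty}\frac{\log\mu(B(x,r))}{r}$, which does not depend on $x\in X$. Tangent bundle: $X$ has a tangent bundle $TX$ if (1) $TX$ is a Polish space with a Borel map $\pi:TX\to X$; (2) for every $a\in X$ the fiber $\pi^{-1}(a)$ is a Banach space, denoted $T_aX$; (3) there is a measurable map $X\times X\to TX$, $(a,x)\mapsto\overrightarrow{ax}$, with $\overrightarrow{ax}\in T_aX$ for all $a,x$ and $\overrightarrow{aa}=0$ for all $a$. Curvature: for $\kappa\leq 0$, the tangent bundle has curvature at most $\kappa$ if for every $C\geq 0$ there exists $D_C\geq 0$ such that for all $a,x,y\in X$ with $d(x,y)\leq C$ one has $\|\overrightarrow{ax}-\overrightarrow{ay}\|\leq D_Ce^{\kappa d(a,x)}$. Proper tangent bundle: the tangent bundle is proper if there exists a proper function $f:[0,+\infty)\to[0,+\infty)$ such that for all $x,y\in X$ and all $p>1$, $\int_{X}\|\overrightarrow{ax}-\overrightarrow{ay}\|^p\,d\mu(a)\geq f(d(x,y))$. $G$-equivariance: when $G$ acts on $X$ by measure-preserving isometries, $TX$ is $G$-equivariant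 if for every $a\in X$ and $g\in G$ there is an isometry $\phi_g:T_aX\to T_{ga}X$ such that $\phi_g(\overrightarrow{ax})=\overrightarrow{(ga)(gx)}$ for every $x\in X$. For $1\leq p<\infty$, $L^p(X,TX)$ is the set of measurable functions $f:X\to TX$ with $f(x)\in T_xX$ for every $x\in X$ and $\|f\|_p=\left(\int_X\|f(x)\|^p\,d\mu(x)\right)^{1/p}<\infty$. An affine isometric action of $G$ on a normed vector space $V$ is given by a representation $\lambda$ of $G$ by linear isometries of $V$ and a map $c:G\to V$ with $c(gh)=c(g)+\lambda(g)c(h)$ for all $g,h\in G$, the action being $gv=\lambda(g)v+c(g)$. It is proper if $\|c(g_n)\|\to\infty$ whenever $(g_n)$ is a sequence leaving every compact subset of $G$; equivalently, $\|g_nv\|\to\infty$ for all $v\in V$ for every such sequence.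
   Formalization: Properness also assumes d(x,g_n x)→∞ when g_n leaves compacts (false otherwise: Z acting on a point); measurable sections are assumed closed under linear combinations with measurable norms, and the φ_g to satisfy φ_1=id, φ_{gh}=φ_gφ_h and preserve measurability. *)

(* Defs.v *)
From HB Require Import structures.
From mathcomp Require Import all_boot all_order all_algebra.
From mathcomp Require Import ring_quotient.
From mathcomp Require Import all_classical all_reals all_analysis.
From mathcomp Require Import measurable_realfun.

Set Implicit Arguments.
Unset Strict Implicit.
Unset Printing Implicit Defensive.

Import Order.TTheory GRing.Theory Num.Theory.
Import numFieldNormedType.Exports.

Local Open Scope classical_set_scope.
Local Open Scope ring_scope.

HB.mixin Record Group_isTopologicalGroup G & Group G & Topological G := {
  mulg_continuous : continuous (fun z : G * G => (z.1 * z.2)%g);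
  invg_continuous : continuous (fun g : G => (g^-1)%g)
}.

#[short(type="topologicalGroupType")]
HB.structure Definition TopologicalGroup :=
  {G of Group G & Topological G & Group_isTopologicalGroup G}.

(* Measurable types are pointed in the library, so a metric space carrying a
   measure has to be nonempty. *)
#[short(type="pmetricType")]
HB.structure Definition PointedMetric (K : numDomainType) :=
  {M of Metric K M & Pointed M}.

HB.saturate prod.

Definition borel (T : ptopologicalType) := g_sigma_algebraType (@open T).

Definition borel_fun (S T : ptopologicalType) (f : S -> T) : Prop :=
  measurable_fun setT (f : borel S -> borel T).

Definition polish_space (R : realType) (T : topologicalType) : Prop :=
  (exists2 D : set T, countable D & dense D) /\
  exists (M : completePseudoMetricType R) (f : T -> M) (g : M -> T),
    [/\ hausdorff_space M, cancel f g, cancel g f,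
        continuous f & continuous g].

Section MetricMeasureSpace.
Context (R : realType) (X : pmetricType R).
Variable mu : {measure set (borel X) -> \bar R}.
Local Open Scope ereal_scope.

Definition radon_measure : Prop :=
  (forall K : set X, compact K -> mu K < +oo) /\
  (forall A : set (borel X), measurable A ->
     mu A = ereal_sup [set mu K | K in [set K : set X | compact K /\ K `<=` A]]).

(* [lne] is the extended logarithm: lne 0 = -oo and lne +oo = +oo. *)
Definition volume_entropy (x : X) : \bar R :=
  limf_esup (fun r : R => lne (mu (ball x r)) * (r^-1)%:E) (pinfty_nbhs R).

End MetricMeasureSpace.

Section Actions.
Context (R : realType) (G : topologicalGroupType) (X : pmetricType R).
Variable act : G -> X -> X.

Definition group_action : Prop :=
  (forall x, act 1%g x = x) /\
  (forall g h x, act (g * h)%g x = act g (act h x)).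

Definition isometric_action : Prop :=
  forall g x y, mdist (act g x) (act g y) = mdist x y.

Definition measure_preserving_action
    (mu : {measure set (borel X) -> \bar R}) : Prop :=
  forall g (A : set (borel X)), measurable A -> mu (act g @^-1` A) = mu A.

Definition leaves_compacts (u : nat -> G) : Prop :=
  forall K : set G, compact K -> \forall n \near \oo, ~ K (u n).

(* Metric properness: orbits leave every ball along sequences that leave every
   compact subset of G. *)
Definition proper_action : Prop :=
  forall (x : X) (u : nat -> G), leaves_compacts u ->
    mdist x (act (u n) x) @[n --> \oo] --> +oo.

End Actions.

(* The fibre pi^-1(a) is presented as a Banach space [tfiber a] together with a
   bijection [tinj a] onto pi^-1(a); a map s : X -> TX with s(a) in T_aX for
   all a is then a dependent function s : forall a, tfiber a. *)
Record pre_tangent_bundle (R : realType) (X : pmetricType R) := PreTangentBundle {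
  tspace : ptopologicalType;
  tproj : tspace -> X;
  tfiber : X -> completeNormedModType R;
  tinj : forall a, tfiber a -> tspace;
  arrow : forall a : X, X -> tfiber a;
  tspace_polish : polish_space R tspace;
  tproj_borel : borel_fun tproj;
  tinj_inj : forall a, injective (@tinj a);
  tinj_range : forall a, range (@tinj a) = tproj @^-1` [set a];
  (* Borel for the product topology on X * X *)
  arrow_borel :
    borel_fun (fun ax : X * X => tinj (arrow ax.1 ax.2));
  arrowxx : forall a, arrow a a = 0
}.

Section Sections.
Context (R : realType) (X : pmetricType R) (B : pre_tangent_bundle X).

Definition tsection : Type := forall a : X, tfiber B a.

HB.instance Definition _ := gen_eqMixin tsection.
HB.instance Definition _ := gen_choiceMixin tsection.

Let add (s t : tsection) : tsection := fun a => s a + t a.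
Let opp (s : tsection) : tsection := fun a => - s a.
Let scale (k : R) (s : tsection) : tsection := fun a => k *: s a.

Let addA : associative add.
Proof. by move=> s t u; apply: functional_extensionality_dep => a; exact: addrA. Qed.
Let addC : commutative add.
Proof. by move=> s t; apply: functional_extensionality_dep => a; exact: addrC. Qed.
Let add0 : left_id ((fun a => 0) : tsection) add.
Proof. by move=> s; apply: functional_extensionality_dep => a; exact: add0r. Qed.
Let addN : left_inverse ((fun a => 0) : tsection) opp add.
Proof. by move=> s; apply: functional_extensionality_dep => a; exact: addNr. Qed.

HB.instance Definition _ := GRing.isZmodule.Build tsection addA addC add0 addN.

Let scaleA k l (s : tsection) : scale k (scale l s) = scale (k * l) s.
Proof. by apply: functional_extensionality_dep => a; exact: scalerA. Qed.
Let scale1 : left_id 1 scale.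
Proof. by move=> s; apply: functional_extensionality_dep => a; exact: scale1r. Qed.
Let scaleDr : right_distributive scale +%R.
Proof. by move=> k s t; apply: functional_extensionality_dep => a; exact: scalerDr. Qed.
Let scaleDl s : {morph scale^~ s : k l / k + l}.
Proof. by move=> k l; apply: functional_extensionality_dep => a; exact: scalerDl. Qed.

HB.instance Definition _ :=
  GRing.Zmodule_isLmodule.Build R tsection scaleA scale1 scaleDr scaleDl.

Lemma tsectionDE (s t : tsection) a : (s + t) a = s a + t a.
Proof. by []. Qed.

Lemma tsectionNE (s : tsection) a : (- s) a = - s a.
Proof. by []. Qed.

Lemma tsectionZE k (s : tsection) a : (k *: s) a = k *: s a.
Proof. by []. Qed.

Lemma tsection0E a : (0 : tsection) a = 0.
Proof. by []. Qed.

Definition measurable_section (s : tsection) : Prop :=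
  borel_fun (fun a => tinj (s a)).

End Sections.

(* The last two fields are the compatibility of the Borel structure of TX with
   the Banach structures of the fibres: without them, L^p(X,TX) need not be a
   vector space, nor the integrals of p-th powers of norms make sense. *)
Record tangent_bundle (R : realType) (X : pmetricType R) := TangentBundle {
  tbundle :> pre_tangent_bundle X;
  measurable_sectionP : forall (k : R) (s t : tsection tbundle),
    measurable_section s -> measurable_section t ->
    measurable_section (k *: s + t);
  measurable_section_norm : forall s : tsection tbundle,
    measurable_section s ->
    measurable_fun setT ((fun a => `|s a|) : borel X -> R)
}.

Section TangentBundleProperties.
Context (R : realType) (X : pmetricType R) (B : tangent_bundle X).

Definition curvature_at_most (kappa : R) : Prop :=
  forall C : R, 0 <= C -> exists2 D : R, 0 <= D &
    forall a x y : X, mdist x y <= C ->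
      `|arrow B a x - arrow B a y| <= D * expR (kappa * mdist a x).

(* [f] stands for a function from [0, +oo[ to [0, +oo[ *)
Definition proper_nonneg_function (f : R -> R) : Prop :=
  (forall t, 0 <= t -> 0 <= f t) /\
  (forall K : set R, compact K ->
     precompact ([set t | 0 <= t] `&` f @^-1` K)).

Definition proper_tangent_bundle
    (mu : {measure set (borel X) -> \bar R}) : Prop :=
  exists2 f : R -> R, proper_nonneg_function f &
    forall (x y : X) (p : R), 1 < p ->
      ((f (mdist x y))%:E <=
       \int[mu]_(a in setT) (`|arrow B a x - arrow B a y| `^ p)%:E)%E.

(* The isometries phi_g : T_aX -> T_{ga}X are those of an action of G on TX by
   measurable bundle maps: besides commuting with the arrows, they satisfy
   phi_1 = id and phi_{gh} = phi_g phi_h (expressed in TX, as the two sides lie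
   in propositionally equal fibres), and they map measurable sections to
   measurable sections.  Linearity is not required: phi_g is onto by the group
   law. *)
Definition equivariant_tangent_bundle (G : topologicalGroupType)
    (act : G -> X -> X) : Prop :=
  exists phi : forall (g : G) (a : X), tfiber B a -> tfiber B (act g a),
    [/\ (forall g a u v, `|phi g a u - phi g a v| = `|u - v|),
        (forall g a x, phi g a (arrow B a x) = arrow B (act g a) (act g x)),
        (forall a u, tinj (phi 1%g a u) = tinj u),
        (forall g h a u,
           tinj (phi (g * h)%g a u) = tinj (phi g (act h a) (phi h a u))) &
        (forall g (s : tsection B), measurable_section s ->
           borel_fun (fun a => tinj (phi g a (s a))))].

End TangentBundleProperties.

Section MeasurableSections.
Context (R : realType) (X : pmetricType R) (B : tangent_bundle X).

Lemma continuous_borel_fun (S T : ptopologicalType) (f : S -> T) :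
  continuous f -> borel_fun f.
Proof.
move=> /continuousP cf; apply: (@measurability _ _ (borel S) (borel T) setT f open) => //.
by move=> _ [U oU <-]; rewrite setTI; apply: sub_sigma_algebra; exact: cf.
Qed.

Lemma borel_fun_comp (S T U : ptopologicalType) (f : T -> U) (g : S -> T) :
  borel_fun f -> borel_fun g -> borel_fun (f \o g).
Proof. by move=> mf mg; exact: (measurableT_comp mf mg). Qed.

Lemma measurable_section0 : measurable_section (0 : tsection B).
Proof.
rewrite /measurable_section.
have -> : (fun a => tinj ((0 : tsection B) a)) =
    (fun ax : X * X => tinj (arrow B ax.1 ax.2)) \o (fun a => (a, a)).
  by apply/funext => a /=; rewrite arrowxx.
apply: borel_fun_comp; first exact: arrow_borel.
by apply: continuous_borel_fun => a; apply: cvg_pair; exact: cvg_id.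
Qed.

End MeasurableSections.

Section LpSpace.
Context (R : realType) (X : pmetricType R).
Variables (mu : {measure set (borel X) -> \bar R}) (B : tangent_bundle X).
Variables (p : R) (p1 : 1 <= p).

Definition section_Lnorm (s : tsection B) : \bar R :=
  Lnorm mu p%:E (fun a : borel X => (`|s a|)%:E).

Let p0 : 0 < p. Proof. exact: lt_le_trans p1. Qed.

Let pn0 : p != 0. Proof. by rewrite gt_eqF. Qed.

Let measurable_powR_norm (s : tsection B) : measurable_section s ->
  measurable_fun setT ((fun a => (`|s a|)%:E `^ p)%E : borel X -> \bar R).
Proof.
move=> ms; apply: (measurableT_comp (measurable_poweR p)).
by apply/measurable_EFinP; exact: measurable_section_norm.
Qed.

Let Lnorm_sectionE (s : tsection B) :
  section_Lnorm s = ((\int[mu]_a (`|s a|)%:E `^ p) `^ p^-1)%E.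
Proof.
rewrite /section_Lnorm unlock; congr (_ `^ _)%E; apply: eq_integral => a _.
by rewrite gee0_abs ?lee_fin.
Qed.

Let Lnorm_sectionZ k (s : tsection B) : measurable_section s ->
  section_Lnorm (k *: s) = (`|k|%:E * section_Lnorm s)%E.
Proof.
move=> ms; rewrite !Lnorm_sectionE.
under eq_integral do
  rewrite tsectionZE normrZ EFinM poweRM ?lee_fin//.
rewrite ge0_integralZl//; last 3 first.
- exact: measurable_powR_norm.
- by move=> a _; exact: poweR_ge0.
- exact: poweR_ge0.
rewrite poweRM ?poweR_ge0//; last by apply: integral_ge0 => a _; exact: poweR_ge0.
by rewrite -poweRrM mulfV// poweRe1 ?lee_fin.
Qed.

Let Lnorm_sectionD (s t : tsection B) :
  measurable_section s -> measurable_section t ->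
  measurable_section (s + t) ->
  (section_Lnorm (s + t)%R <= section_Lnorm s + section_Lnorm t)%E.
Proof.
move=> ms mt mst.
have mN (u : tsection B) : measurable_section u ->
    measurable_fun setT ((fun a => `|u a|) : borel X -> R).
  exact: measurable_section_norm.
apply: le_trans (minkowski_EFin mu (mN _ ms) (mN _ mt) p1).
rewrite Lnorm_sectionE unlock.
apply: gt0_ler_poweR.
- by rewrite invr_ge0 ltW.
- by rewrite in_itv/= leey andbT; apply: integral_ge0 => a _; rewrite lee_fin powR_ge0.
- by rewrite in_itv/= leey andbT; apply: integral_ge0 => a _; rewrite lee_fin powR_ge0.
apply: ge0_le_integral => //.
- by move=> a _; exact: poweR_ge0.
- exact: measurable_powR_norm.
- apply: (measurableT_comp (measurable_poweR p)).
  apply: measurableT_comp => //; apply/measurable_EFinP.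
  by apply: measurable_funD; exact: mN.
- move=> a _; apply: gt0_ler_poweR; first exact: ltW.
  + by rewrite in_itv/= leey andbT lee_fin.
  + by rewrite in_itv/= leey andbT.
  + by rewrite /= lee_fin (le_trans (ler_normD _ _))// ler_norm.
Qed.

Let Lnorm_section_eq0 (s : tsection B) : measurable_section s ->
  section_Lnorm s = 0%E <-> {ae mu, forall a : borel X, s a = 0}.
Proof.
move=> ms; split=> [|s0].
  move=> /Lnorm_eq0_eq0 h.
  have := h _; rewrite lte_fin => /(_ _ p0) h'.
  have {h h'}/h' : measurable_fun setT ((fun a => (`|s a|)%:E) : borel X -> \bar R).
    by apply/measurable_EFinP; exact: measurable_section_norm.
  apply: filterS => a /(_ I) /= [] /eqP.
  by rewrite normr_eq0 => /eqP.
rewrite Lnorm_sectionE (ae_eq_integral (cst 0%E))//.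
- by rewrite integral0 poweR0r// invr_eq0.
- exact: measurable_powR_norm.
- by move: s0; apply: filterS => a -> _; rewrite normr0 poweR0r.
Qed.

(* The bound on the exponent is an argument: it makes this a subspace. *)
Definition Lp_pred of 1 <= p : {pred tsection B} :=
  fun s => `[< measurable_section s /\ (section_Lnorm s < +oo)%E >].

Lemma Lp_submod_closed : submod_closed (Lp_pred p1).
Proof.
split=> [|k s t /asboolP[ms sy] /asboolP[mt ty]].
  apply/asboolP; split; first exact: measurable_section0.
  rewrite (Lnorm_section_eq0 _).2 ?ltry//; first exact: measurable_section0.
  exact: aeW.
have mks : measurable_section (k *: s).
  have := measurable_sectionP k ms (@measurable_section0 _ _ B).
  by rewrite addr0.
have mkst := measurable_sectionP k ms mt.
apply/asboolP; split => //.
apply: (le_lt_trans (Lnorm_sectionD mks mt mkst)).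
rewrite Lnorm_sectionZ// lte_add_pinfty// lte_mul_pinfty ?lee_fin//.
Qed.

HB.instance Definition _ :=
  GRing.isSubmodClosed.Build R (tsection B) (Lp_pred p1) Lp_submod_closed.

Record Lp_section := LpSection {
  Lp_val :> tsection B;
  Lp_valP : Lp_val \in Lp_pred p1
}.

HB.instance Definition _ := [isSub for Lp_val].
HB.instance Definition _ := [Choice of Lp_section by <:].
HB.instance Definition _ := [SubChoice_isSubLmodule of Lp_section by <:].

Implicit Types s t : Lp_section.

Lemma Lp_section_measurable s : measurable_section s.
Proof. by have /asboolP[] := Lp_valP s. Qed.

Lemma Lp_section_finite s : section_Lnorm s \is a fin_num.
Proof.
have /asboolP[_ sy] := Lp_valP s.
by rewrite ge0_fin_numE// Lnorm_ge0.
Qed.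

Let nm s : R := fine (section_Lnorm s).

Let nmZ k s : nm (k *: s) = `|k| * nm s.
Proof.
rewrite /nm Lnorm_sectionZ; last exact: Lp_section_measurable.
by rewrite fineM// Lp_section_finite.
Qed.

Let nmD s t : nm (s + t) <= nm s + nm t.
Proof.
rewrite /nm -fineD ?Lp_section_finite//.
rewrite fine_le ?fin_numD ?Lp_section_finite//.
by apply: Lnorm_sectionD; [exact: Lp_section_measurable..|
  exact: (Lp_section_measurable (s + t))].
Qed.

Let nm_ge0 s : 0 <= nm s.
Proof. by apply: fine_ge0; exact: Lnorm_ge0. Qed.

Definition Lp_null : {pred Lp_section} :=
  fun s => `[< {ae mu, forall a : borel X, Lp_val s a = 0} >].

Let Lp_nullP s : reflect (nm s = 0) (s \in Lp_null).
Proof.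
apply: (iffP idP) => [/asboolP s0|s0].
  by rewrite /nm (Lnorm_section_eq0 _).2//; exact: Lp_section_measurable.
apply/asboolP/(Lnorm_section_eq0 _).1; first exact: Lp_section_measurable.
by rewrite -[LHS]fineK ?Lp_section_finite// -/(nm s) s0.
Qed.

Lemma Lp_null_zmod_closed : zmod_closed Lp_null.
Proof.
split=> [|s t /Lp_nullP s0 /Lp_nullP t0].
  by apply/Lp_nullP; have := nmZ 0 0; rewrite scale0r normr0 mul0r.
apply/Lp_nullP/eqP; rewrite eq_le nm_ge0 andbT.
rewrite (le_trans (nmD _ _))// s0 add0r -scaleN1r nmZ t0 mulr0//.
Qed.

HB.instance Definition _ :=
  GRing.isZmodClosed.Build Lp_section Lp_null Lp_null_zmod_closed.

Definition Lp : Type := Quotient.quot Lp_null.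

HB.instance Definition _ := GRing.Zmodule.on Lp.
HB.instance Definition _ := EqQuotient.on Lp.

(* the class modulo equality almost everywhere *)
Definition Lp_class (s : Lp_section) : Lp := \pi_Lp%qT s.

Let Lp_classP s t : Lp_class s = Lp_class t <-> nm (s - t) = 0.
Proof.
split=> [/eqP|]; rewrite /Lp_class.
  by rewrite -Quotient.idealrBE => /Lp_nullP.
by move=> /Lp_nullP; rewrite Quotient.idealrBE => /eqP.
Qed.

Lemma Lp_classK (x : Lp) : Lp_class (repr x) = x.
Proof. exact: reprK. Qed.

Lemma Lp_classD s t : Lp_class (s + t) = Lp_class s + Lp_class t.
Proof. exact: Quotient.pi_add. Qed.

Let Lp_scale (k : R) (x : Lp) : Lp := Lp_class (k *: repr x).

Let Lp_scaleE k s : Lp_scale k (Lp_class s) = Lp_class (k *: s).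
Proof.
apply/Lp_classP; rewrite -scalerBr nmZ.
by have /Lp_classP -> := Lp_classK (Lp_class s); rewrite mulr0.
Qed.

Let scaleA k l x : Lp_scale k (Lp_scale l x) = Lp_scale (k * l) x.
Proof. by rewrite -[x]Lp_classK !Lp_scaleE scalerA. Qed.

Let scale1 : left_id 1 Lp_scale.
Proof. by move=> x; rewrite -[x]Lp_classK Lp_scaleE scale1r. Qed.

Let scaleDr : right_distributive Lp_scale +%R.
Proof.
move=> k x y; rewrite -[x]Lp_classK -[y]Lp_classK -Lp_classD !Lp_scaleE.
by rewrite scalerDr Lp_classD.
Qed.

Let scaleDl x : {morph Lp_scale^~ x : k l / k + l}.
Proof.
by move=> k l; rewrite -[x]Lp_classK !Lp_scaleE scalerDl Lp_classD.
Qed.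

HB.instance Definition _ :=
  GRing.Zmodule_isLmodule.Build R Lp scaleA scale1 scaleDr scaleDl.

Lemma Lp_classZ k s : Lp_class (k *: s) = k *: Lp_class s.
Proof. by rewrite -Lp_scaleE. Qed.

Definition Lp_norm (x : Lp) : R := fine (section_Lnorm (repr x)).

Let Lp_norm_class s : Lp_norm (Lp_class s) = nm s.
Proof.
have le_nm (u v : Lp_section) : Lp_class u = Lp_class v -> nm u <= nm v.
  by move=> /Lp_classP uv; rewrite -[u](subrK v) (le_trans (nmD _ _))// uv add0r.
by apply/eqP; rewrite eq_le; apply/andP; split; apply: le_nm; rewrite Lp_classK.
Qed.

Let Lp_normD x y : Lp_norm (x + y) <= Lp_norm x + Lp_norm y.
Proof.
by rewrite -[x]Lp_classK -[y]Lp_classK -Lp_classD !Lp_norm_class nmD.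
Qed.

Let Lp_normZ k x : Lp_norm (k *: x) = `|k| * Lp_norm x.
Proof. by rewrite -[x]Lp_classK -Lp_classZ !Lp_norm_class nmZ. Qed.

Let Lp_norm0_eq0 x : Lp_norm x = 0 -> x = 0.
Proof.
rewrite -[x]Lp_classK Lp_norm_class => x0.
rewrite -[RHS]Lp_classK; apply/Lp_classP/eqP; rewrite eq_le nm_ge0 andbT.
have r0 : nm (repr (0 : Lp)) = 0.
  by have := Lp_normZ 0 0; rewrite scale0r normr0 mul0r.
by apply: le_trans (nmD _ _) _; rewrite -scaleN1r nmZ x0 r0 mulr0 addr0.
Qed.

HB.instance Definition _ :=
  Lmodule_isNormed.Build R Lp Lp_normD Lp_normZ Lp_norm0_eq0.

Lemma Lp_normE s : `|Lp_class s| = fine (section_Lnorm s).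
Proof. exact: Lp_norm_class. Qed.

End LpSpace.

Section AffineActions.
Context (R : realType) (G : topologicalGroupType).

Record affine_isometric_action (V : normedModType R) := AffineIsometricAction {
  linear_part : G -> {linear V -> V};
  translation_part : G -> V;
  linear_part1 : forall v, linear_part 1%g v = v;
  linear_partM : forall g h v,
    linear_part (g * h)%g v = linear_part g (linear_part h v);
  linear_part_isometry : forall g v, `|linear_part g v| = `|v|;
  translation_partM : forall g h,
    translation_part (g * h)%g =
    translation_part g + linear_part g (translation_part h)
}.

Definition proper_affine_action (V : normedModType R)
    (alpha : affine_isometric_action V) : Prop :=
  forall u : nat -> G, leaves_compacts u ->
    `|translation_part alpha (u n)| @[n --> \oo] --> +oo.

End AffineActions.

Arguments affine_isometric_action {R} G V.

(* Main.v *)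
(* The cocycle is the vector field a |-> arrow a (g x0) - arrow a x0, the
   formal coboundary of the possibly non-integrable field a |-> arrow a x0.
   Curvature at most kappa bounds its norm at a by
   D * exp (kappa * d(a, x0)), and since balls grow like exp (k * r) for any
   k > h, summing over annuli shows that its p-th power is integrable when
   p |kappa| > h.  The linear part pushes sections forward by the isometries
   phi_g; these fix 0 = arrow a a and are invertible by the group law, hence
   linear by the Mazur-Ulam theorem.  Properness is read off from
   ||c(g)||^p >= f (d(g x0, x0)). *)
Require Import Defs.
From HB Require Import structures.
From mathcomp Require Import all_boot all_order all_algebra.
From mathcomp Require Import all_classical all_reals all_analysis.
From mathcomp Require Import measurable_realfun.

Set Implicit Arguments.
Unset Strict Implicit.
Unset Printing Implicit Defensive.

Import Order.TTheory GRing.Theory Num.Theory.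
Import numFieldNormedType.Exports.

Local Open Scope classical_set_scope.
Local Open Scope ring_scope.

(** * The Mazur-Ulam theorem *)

Section MazurUlam.
Context (R : realType).

Definition isometry (V W : normedModType R) (f : V -> W) : Prop :=
  forall u v, `|f u - f v| = `|u - v|.

Lemma isometry_reflection (V : normedModType R) (c : V) :
  isometry (fun w => c - w).
Proof. by move=> u v; rewrite opprB addrC addrA subrK distrC. Qed.

Lemma midpoint_reflection (V : normedModType R) (a b : V) :
  a + b - 2^-1 *: (a + b) = 2^-1 *: (a + b).
Proof.
rewrite -[X in X - _]scale1r -scalerBl; congr (_ *: _).
by rewrite [X in X - _](splitr 1) !div1r addrK.
Qed.

(** Both limiting arguments below end here: the Archimedean property rules out a positive [d]. *)
Lemma eq0_of_natmul_le (c d : R) : 0 <= d ->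
  (forall n : nat, d * n%:R <= c) -> d = 0.
Proof.
move=> d0 dn; apply/eqP; rewrite eq_le d0 andbT leNgt; apply/negP => d_gt0.
have c0 : 0 <= c by have := dn 0%N; rewrite mulr0.
have := dn (Num.truncn (c / d)).+1; rewrite mulrC -ler_pdivlMr// leNgt.
by rewrite truncnS_gt.
Qed.

(* Vaisala's proof of the Mazur-Ulam theorem: with [r w = a + b - w], the
   isometry [r \o f^-1 \o r \o f] also fixes [a] and [b], and it moves the
   midpoint [z] twice as far as [f] does. *)
Lemma isometry_fixed_midpoint_le (V : normedModType R) (a b : V) (n : nat)
    (f g : V -> V) (z := 2^-1 *: (a + b)) :
  cancel f g -> cancel g f -> isometry f -> f a = a -> f b = b ->
  `|f z - z| * 2 ^+ n <= 2 * `|a - z|.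
Proof.
have reflz : a + b - z = z by exact: midpoint_reflection.
elim: n f g => [|n IH] f g fK gK iso_f fa fb.
  rewrite expr0 mulr1 (le_trans (ler_distD a _ _))// mulr2n mulrDl !mul1r.
  by rewrite lerD2r -{1}fa iso_f distrC.
have gE x y : f y = x -> g x = y by move=> <-.
have iso_g : isometry g by move=> u v; rewrite -iso_f !gK.
pose r w := a + b - w.
have rK : involutive r by exact: subKr.
have iso_r : isometry r by exact: isometry_reflection.
have := IH (r \o g \o r \o f) (g \o r \o f \o r).
rewrite /=; move=> /(_ _ _ _ _ _) IH'.
have {IH'} : `|r (g (r (f z))) - z| * 2 ^+ n <= 2 * `|a - z|.
  have ra : r a = b by rewrite /r addrC addKr.
  have rb : r b = a by rewrite /r addrK.
  apply: IH'.
  - by move=> w /=; rewrite rK gK rK fK.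
  - by move=> w /=; rewrite gK rK fK rK.
  - by move=> u v; rewrite /= iso_r iso_g iso_r iso_f.
  - by rewrite fa ra (gE _ b)// rb.
  - by rewrite fb rb (gE _ a)// ra.
(* Since [r] fixes [z], the outer [r] drops; applying [f] then leaves the distance from [r (f z)] to
   [f z]. *)
rewrite -{2}reflz -/(r z) iso_r.
have -> : `|g (r (f z)) - z| = 2 * `|f z - z|.
  rewrite -iso_f gK /r -normrN.
  have -> : - (a + b - f z - f z) = 2 *: (f z - z).
    rewrite scalerBr /z scalerA divff// scale1r scaler_nat mulr2n.
    by rewrite -addrA -opprD opprB.
  by rewrite normrZ ger0_norm.
by rewrite exprS mulrCA mulrA.
Qed.

(** The displacement of the midpoint stays bounded after multiplication by [2 ^+ n], which exceeds
    [n]. *)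
Lemma isometry_fixed_midpoint (V : normedModType R) (a b : V) (f g : V -> V) :
  cancel f g -> cancel g f -> isometry f -> f a = a -> f b = b ->
  f (2^-1 *: (a + b)) = 2^-1 *: (a + b).
Proof.
move=> fK gK iso_f fa fb; apply/eqP; rewrite -subr_eq0 -normr_eq0; apply/eqP.
apply: (@eq0_of_natmul_le (2 * `|a - 2^-1 *: (a + b)|)) => // n.
apply: le_trans (isometry_fixed_midpoint_le n fK gK iso_f fa fb).
by rewrite ler_wpM2l// -natrX ler_nat ltnW// ltn_expl.
Qed.

Context (V W : normedModType R) (f : V -> W) (g : W -> V).
Hypotheses (fK : cancel f g) (gK : cancel g f) (iso_f : isometry f).

Lemma isometry_midpoint (a b : V) :
  f (2^-1 *: (a + b)) = 2^-1 *: (f a + f b).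
Proof.
have iso_g : isometry g by move=> u v; rewrite -iso_f !gK.
pose r w := a + b - w; pose r' w := f a + f b - w.
have rK : involutive r by exact: subKr.
have r'K : involutive r' by exact: subKr.
have iso_r : isometry r by exact: isometry_reflection.
have iso_r' : isometry r' by exact: isometry_reflection.
have half (U : normedModType R) (u v : U) : u + u = v -> u = 2^-1 *: v.
  by move=> <-; rewrite -mulr2n -[u *+ 2]scaler_nat scalerA mulVf// scale1r.
pose z := 2^-1 *: (a + b).
(* [f] followed by [r'] sends [a] to [f b], and [g] followed by [r] returns it to [a]; likewise for
   [b]. The composite therefore fixes the midpoint [z]. *)
have : (r \o g \o r' \o f) z = z.
  apply: (@isometry_fixed_midpoint _ a b _ (g \o r' \o f \o r)).
  - by move=> w /=; rewrite rK gK r'K fK.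
  - by move=> w /=; rewrite gK r'K fK rK.
  - by move=> u v; rewrite /= iso_r iso_g iso_r' iso_f.
  - by rewrite /= /r' addrC addKr fK /r addrK.
  - by rewrite /= /r' addrK fK /r addrC addKr.
have rz : r z = z by exact: midpoint_reflection.
move=> /(congr1 r); rewrite /= rK rz => /(congr1 f); rewrite gK => fz.
by apply: half; rewrite -{1}fz /r' subrK.
Qed.

Hypothesis f0 : f 0 = 0.

(** Taking one endpoint at [0] makes [f] commute with halving, so preservation of midpoints doubles
    to additivity. *)
Lemma isometry_additive (u v : V) : f (u + v) = f u + f v.
Proof.
have fhalf w : f (2^-1 *: w) = 2^-1 *: f w.
  by have := isometry_midpoint w 0; rewrite f0 !addr0.
apply: (scalerI (_ : 2^-1 != 0 :> R)); first by rewrite invr_eq0.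
by rewrite -fhalf isometry_midpoint.
Qed.

(** Additivity gives integer scalars; the isometry property controls the error on real ones. *)
Lemma isometry_scalable (k : R) (v : V) : f (k *: v) = k *: f v.
Proof.
have fN w : f (- w) = - f w.
  by apply/eqP; rewrite -addr_eq0 -isometry_additive addNr f0.
have fMn w n : f (w *+ n) = f w *+ n.
  by elim: n => [|n IH]; rewrite ?f0// !mulrS isometry_additive IH.
have fMz w (m : int) : f (m%:~R *: w) = m%:~R *: f w.
  rewrite !scaler_int; case: m => m; first by rewrite -!pmulrn fMn.
  by rewrite NegzE !mulrNz fN -!pmulrn fMn.
have fnorm w : `|f w| = `|w| by have := iso_f w 0; rewrite f0 !subr0.
apply/eqP; rewrite -subr_eq0 -normr_eq0; apply/eqP.
apply: (@eq0_of_natmul_le (2 * `|v|)) => // n.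
(* [n * (f (k *: v) - k *: f v)] stays bounded, by comparing [n * k] with its
   integer part. *)
pose m := Num.floor (n%:R * k).
have floor_le : `|n%:R * k - m%:~R| <= 1.
  rewrite /m ger0_norm ?subr_ge0 ?floor_le// lerBlDl.
  by have /ltW := floorD1_gt (n%:R * k); rewrite intrD.
have -> : `|f (k *: v) - k *: f v| * n%:R =
    `|f ((n%:R * k) *: v) - (n%:R * k) *: f v|.
  have -> : f ((n%:R * k) *: v) = f (k *: v) *+ n.
    by rewrite -scalerA scaler_nat fMn.
  by rewrite -[(_ * _) *: f v]scalerA [n%:R *: _]scaler_nat -mulrnBl
    normrMn mulr_natr.
rewrite (le_trans (ler_distD (m%:~R *: f v) _ _))// mulr2n mulrDl mul1r lerD//.
  by rewrite -fMz iso_f -scalerBl normrZ ler_piMl.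
by rewrite -scalerBl normrZ fnorm distrC ler_piMl.
Qed.

End MazurUlam.

(** * Growth of balls and integrability of exponentially decaying functions *)

Section BallGrowth.
Context (R : realType) (X : pmetricType R).
Variable mu : {measure set (borel X) -> \bar R}.

Lemma metric_ball_open (x : X) (r : R) : open (ball x r).
Proof.
rewrite openE => y; rewrite ballEmdist/= => xy.
apply/nbhs_ballP; exists (r - mdist x y); rewrite /= ?subr_gt0//.
move=> z; rewrite !ballEmdist/= ltrBrDl; apply: le_lt_trans.
exact: metric_triangle.
Qed.

Lemma borel_open (A : set X) : open A -> measurable (A : set (borel X)).
Proof. exact: sub_sigma_algebra. Qed.

(** Beyond [r0] the entropy gives the bound with constant 1; smaller balls lie in [ball x r0], and
    the constant [expR (k * r0)] absorbs them. *)
Lemma ball_exponential_growth (x : X) (h k : R) :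
  volume_entropy mu x = h%:E -> h < k -> 0 <= k ->
  exists2 C : R, 0 <= C & forall r : R, 0 <= r ->
    (mu (ball x r) <= (C * expR (k * r))%:E)%E.
Proof.
move=> entropy hk k0.
have : (volume_entropy mu x < k%:E)%E by rewrite entropy lte_fin.
(* The limit superior is an infimum of suprema: on some neighbourhood [V] of infinity, containing
   all radii above [A], the supremum is below [k]. *)
move=> /ereal_inf_lt[_ [V [A [_ AV]] <-] Vk].
(* The added 1 puts [r0] strictly above [A]; the maximum with 1 keeps radii positive, so that
   division by [r] can be undone. *)
pose r0 := Num.max A 1 + 1.
have growth r : r0 <= r -> (mu (ball x r) <= (expR (k * r))%:E)%E.
  move=> r0r.
  have lt_max (u : R) : u <= Num.max A 1 -> u < r.
    move=> ?; rewrite (lt_le_trans _ r0r)//.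
    by rewrite (@le_lt_trans _ _ (Num.max A 1))// /r0 ltrDl.
  have Ar : A < r by rewrite lt_max// le_max lexx.
  have r_gt0 : 0 < r by rewrite lt_max// le_max ler01 orbT.
  have : (lne (mu (ball x r)) * (r^-1)%:E < k%:E)%E.
    apply: le_lt_trans Vk; apply: ereal_sup_ubound.
    by exists r => //; exact: AV.
  rewrite lte_pdivrMr// -EFinM => /ltW.
  rewrite -lee_expeR lneK//.
  by rewrite in_itv/= leey andbT.
exists (expR (k * r0)); first exact: expR_ge0.
move=> r r_ge0; have [r0r|/ltW rr0] := leP r0 r.
  rewrite (le_trans (growth _ r0r))// lee_fin ler_peMl ?expR_ge0//.
  rewrite -expR0 ler_expR mulr_ge0// addr_ge0//.
  by rewrite le_max ler01 orbT.
rewrite (@le_trans _ _ (mu (ball x r0)))//.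
  apply: le_measure; last exact: le_ball.
    by rewrite inE; apply: borel_open; exact: metric_ball_open.
  by rewrite inE; apply: borel_open; exact: metric_ball_open.
rewrite (le_trans (growth _ _))// lee_fin ler_peMr ?expR_ge0//.
by rewrite -expR0 ler_expR mulr_ge0.
Qed.

Lemma integral_exponential_decay_lty (x : X) (h c K : R) (f : borel X -> R) :
  volume_entropy mu x = h%:E -> h < c -> 0 < c -> 0 <= K ->
  measurable_fun setT f -> (forall a, 0 <= f a) ->
  (forall a : X, f a <= K * expR (- c * mdist x a)) ->
  (\int[mu]_a (f a)%:E < +oo)%E.
Proof.
move=> entropy hc c0 K0 mf f0 f_le.
(* The rate [k] is the midpoint of [Num.max h 0] and [c]: large enough for the growth bound, small
   enough for the series to converge. *)
have [k [k0 hk kc]] : exists k : R, [/\ 0 <= k, h < k & k < c].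
  have mc : Num.max h 0 < c by rewrite gt_max hc c0.
  have [mk kc] := midf_lt mc; exists ((Num.max h 0 + c) / 2); split => //.
    by rewrite (le_trans _ (ltW mk))// le_max lexx orbT.
  by rewrite (le_lt_trans _ mk)// le_max lexx.
have [C C0 growth] := ball_exponential_growth entropy hk k0.
(* On the annulus [n <= mdist x a < n + 1], [f] is at most
   [K * expR (- c * n)]. *)
pose F n (a : borel X) : \bar R :=
  ((K * expR (- c * n%:R))%:E * (\1_(ball x n.+1%:R) a)%:E)%E.
have mball n : measurable (ball x n.+1%:R : set (borel X)).
  by apply: borel_open; exact: metric_ball_open.
have F0 n a : (0 <= F n a)%E.
  by apply: mule_ge0; rewrite lee_fin ?mulr_ge0 ?expR_ge0.
have mF n : measurable_fun setT (F n).
  by apply: emeasurable_funM => //; apply/measurable_EFinP;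
    exact: measurable_indic.
have le_F (a : X) :
    ((f a)%:E <= \sum_(0 <= n <oo) F n a)%E.
  (* The term of index [N] alone dominates [f a]: the distance is at least [N] and less than the
     radius [N + 1] of its ball. *)
  set N := Num.truncn (mdist x a).
  have /andP[Nd dN] := truncn_itv (mdist_ge0 x a).
  apply: le_trans (nneseries_lim_ge N.+1 (fun n _ _ => F0 n a)).
  rewrite big_nat_recr//=; apply: le_trans (leeDr _ _); last first.
    by apply: sume_ge0 => n _; exact: F0.
  rewrite /F indicE mem_set ?mule1 ?lee_fin; last by rewrite ballEmdist.
  rewrite (le_trans (f_le a))// ler_wpM2l// ler_expR.
  by rewrite !mulNr lerN2 ler_wpM2l// ltW.
apply: (@le_lt_trans _ _ (\int[mu]_a (\sum_(0 <= n <oo) F n a))%E).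
  apply: ge0_le_integral => //.
  - by move=> a _; rewrite lee_fin.
  - exact/measurable_EFinP.
  - exact: ge0_emeasurable_sum.
rewrite integral_nneseries//.
pose z := expR (k - c).
have z1 : z < 1 by rewrite -expR0 ltr_expR subr_lt0.
(* The radius [n + 1] costs a factor [expR k] in the constant, and the ratio is
   [z = expR (k - c)]. *)
have intF n : (\int[mu]_a F n a <= (geometric (K * C * expR k) z n)%:E)%E.
  rewrite ge0_integralZl ?lee_fin ?mulr_ge0 ?expR_ge0//; last first.
    by apply/measurable_EFinP; exact: measurable_indic.
  rewrite integral_indic// setIT.
  apply: le_trans (lee_wpmul2l _ (growth _ _)) _;
    rewrite ?lee_fin ?mulr_ge0 ?expR_ge0//.
  rewrite /geometric/= /z -expRM_natr mulrACA -!mulrA -!expRD.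
  rewrite ler_wpM2l// ler_wpM2l// ler_expR.
  by rewrite -natr1 mulrDr mulr1 mulrBl mulNr [- _ + _]addrC addrAC addrC.
apply: (@le_lt_trans _ _ (K * C * expR k / (1 - z))%:E); last exact: ltry.
apply: lime_le.
  by apply: is_cvg_nneseries => n _ _; exact: integral_ge0.
apply: nearW => n.
apply: le_trans (lee_sum _ (fun i _ => intF i)) _.
rewrite sumEFin lee_fin.
have -> : \sum_(0 <= i < n) geometric (K * C * expR k) z i =
    series (geometric (K * C * expR k) z) n by [].
rewrite geometric_seriesE ?lt_eqF//= ler_wpM2r//.
  by rewrite invr_ge0 subr_ge0 ltW.
rewrite ler_piMr ?mulr_ge0 ?expR_ge0//.
by rewrite gerBl exprn_ge0// expR_ge0.
Qed.

End BallGrowth.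

(** * Arrow differences in [L^p] and transport between fibres *)

Section Preliminaries.
Context (R : realType) (X : pmetricType R).
Variable mu : {measure set (borel X) -> \bar R}.

Lemma ge0_integral_measure_preserving (T : X -> X) (f : borel X -> \bar R) :
  borel_fun T ->
  (forall A : set (borel X), measurable A -> mu (T @^-1` A) = mu A) ->
  measurable_fun setT f -> (forall a, 0 <= f a)%E ->
  (\int[mu]_a f (T a) = \int[mu]_a f a)%E.
Proof.
move=> mT muT mf f0.
have := @ge0_integral_pushforward _ _ _ _ _ _ mT mu setT f measurableT mf.
rewrite preimage_setT => <-; last by move=> ? _.
by apply: eq_measure_integral => A mA _; exact: muT.
Qed.

Context (B : tangent_bundle X).

Lemma section_LnormE (p : R) (s : tsection B) :
  0 < p -> section_Lnorm mu p s = ((\int[mu]_a (`|s a| `^ p)%:E) `^ p^-1)%E.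
Proof.
move=> p0; rewrite /section_Lnorm unlock; congr (_ `^ _)%E.
by apply: eq_integral => a _; rewrite abse_EFin normr_id poweR_EFin.
Qed.

Lemma measurable_arrow (x : X) :
  measurable_section ((fun a => arrow B a x) : tsection B).
Proof.
apply: (@borel_fun_comp _ _ _ (fun ax : X * X => tinj (arrow B ax.1 ax.2))
  (fun a => (a, x))); first exact: arrow_borel.
by apply: continuous_borel_fun => a; apply: cvg_pair;
  [exact: cvg_id|exact: cvg_cst].
Qed.

Definition arrow_diff (x y : X) : tsection B :=
  fun a => arrow B a x - arrow B a y.

Lemma measurable_arrow_diff (x y : X) : measurable_section (arrow_diff x y).
Proof.
have := measurable_sectionP (-1) (measurable_arrow y) (measurable_arrow x).
by rewrite scaleN1r addrC.
Qed.

(** With [C] the distance from [x] to [y], the [p]-th power of the curvature bound decays at rate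
    [|kappa| * p], which exceeds [h]. *)
Lemma arrow_diff_Lp (h kappa p : R) (p1 : 1 <= p) (x y : X) :
  volume_entropy mu x = h%:E -> kappa < 0 -> curvature_at_most B kappa ->
  h / `|kappa| < p -> arrow_diff x y \in Lp_pred mu p1.
Proof.
move=> entropy kappa0 curv hp.
have p0 : 0 < p by exact: lt_le_trans p1.
apply/asboolP; split; first exact: measurable_arrow_diff.
have [D D0 arrow_le] := curv _ (mdist_ge0 x y).
rewrite section_LnormE//; apply: poweR_lty.
apply: (integral_exponential_decay_lty (x := x) (h := h) (c := `|kappa| * p)
  (K := D `^ p)) => //.
- by rewrite mulrC -ltr_pdivrMr// normr_gt0 lt_eqF.
- by rewrite mulr_gt0// normr_gt0 lt_eqF.
- exact: powR_ge0.
- apply: (measurableT_comp (measurable_powR _)) => //.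
  by apply: measurable_section_norm; exact: measurable_arrow_diff.
- move=> a; rewrite ltr0_norm// [- kappa * p]mulNr opprK mulrAC.
  rewrite expRM -powRM ?expR_ge0//.
  rewrite ge0_ler_powR ?nnegrE ?mulr_ge0 ?expR_ge0//; first exact: ltW.
  by rewrite metric_sym; exact: arrow_le.
Qed.

(* [act g (act g^-1 a)] is only propositionally equal to [a]. *)
Definition fiber_cast (a b : X) (e : a = b) (u : tfiber B a) : tfiber B b :=
  ecast c (tfiber B c) e u.

(** Identities between propositionally equal fibres are checked in [TX], where transports
    disappear. *)
Lemma tinj_cast a b (e : a = b) u : tinj (fiber_cast e u) = tinj u.
Proof. by case: b / e. Qed.

Lemma norm_fiber_cast a b (e : a = b) u : `|fiber_cast e u| = `|u|.
Proof. by case: b / e. Qed.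

Lemma fiber_castP a b (e : a = b) k u v :
  fiber_cast e (k *: u + v) = k *: fiber_cast e u + fiber_cast e v.
Proof. by case: b / e. Qed.

Lemma fiber_cast_arrow a b (e : a = b) x :
  fiber_cast e (arrow B a x) = arrow B b x.
Proof. by case: b / e. Qed.

End Preliminaries.

(** * The action of the group on sections *)

Section SectionAction.
Context (R : realType) (X : pmetricType R) (B : tangent_bundle X).
Context (G : topologicalGroupType) (act : G -> X -> X).
Hypotheses (act_group : group_action act) (act_iso : isometric_action act).

Lemma actK g a : act g^-1%g (act g a) = a.
Proof. by rewrite -act_group.2 mulVg act_group.1. Qed.

Lemma actVK g a : act g (act g^-1%g a) = a.
Proof. by rewrite -act_group.2 mulgV act_group.1. Qed.

Lemma act_borel_fun g : borel_fun (act g).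
Proof.
apply: continuous_borel_fun => a.
apply/metricType_numDomainType.cvgrPdist_lt => e e0.
apply/metricType_numDomainType.nbhs_mdistP; exists e => //= b.
by rewrite act_iso.
Qed.

Variable phi : forall (g : G) (a : X), tfiber B a -> tfiber B (act g a).
Hypothesis phi_iso : forall g a u v,
  `|phi g u - phi g v : tfiber B (act g a)| = `|u - v|.
Hypothesis phi_arrow : forall g a x,
  phi g (arrow B a x) = arrow B (act g a) (act g x).
Hypothesis phi1 : forall a (u : tfiber B a), tinj (phi 1%g u) = tinj u.
Hypothesis phiM : forall g h a (u : tfiber B a),
  tinj (phi (g * h)%g u) = tinj (phi g (phi h u)).
Hypothesis phi_measurable : forall g (s : tsection B), measurable_section s ->
  borel_fun (fun a => tinj (phi g (s a))).

Lemma tinj_phi_cast g a b (e : a = b) (u : tfiber B a) :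
  tinj (phi g (fiber_cast e u)) = tinj (phi g u).
Proof. by case: b / e. Qed.

Lemma phi_linear g a k (u v : tfiber B a) :
  phi g (k *: u + v) = k *: phi g u + phi g v.
Proof.
(* The inverse of [phi g] on this fibre: [phi g^-1], transported from [g^-1 (g a)] back to [a]. *)
pose psi v := fiber_cast (actK g a) (phi g^-1%g v).
have phiK : cancel (@phi g a) psi.
  by move=> w; apply: tinj_inj; rewrite tinj_cast -phiM mulVg phi1.
have psiK : cancel psi (@phi g a).
  by move=> w; apply: tinj_inj; rewrite tinj_phi_cast -phiM mulgV phi1.
have iso_phi : isometry (@phi g a) by move=> w w'; exact: phi_iso.
have phi0 : @phi g a 0 = 0.
  by rewrite -[0 in LHS](arrowxx B a) phi_arrow arrowxx.
by rewrite (isometry_additive phiK psiK)// (isometry_scalable phiK psiK).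
Qed.

Lemma norm_phi g a (u : tfiber B a) : `|phi g u| = `|u|.
Proof.
have := phi_iso g u (arrow B a a).
by rewrite phi_arrow !arrowxx !subr0.
Qed.

(** Pushforward of sections; the cast brings the value from the fibre over [g (g^-1 a)] to the one
    over [a]. *)
Definition section_act (g : G) (s : tsection B) : tsection B :=
  fun a => fiber_cast (actVK g a) (phi g (s (act g^-1%g a))).

Lemma norm_section_act g s a : `|section_act g s a| = `|s (act g^-1%g a)|.
Proof. by rewrite norm_fiber_cast norm_phi. Qed.

Lemma measurable_section_act g s :
  measurable_section s -> measurable_section (section_act g s).
Proof.
move=> ms; rewrite /measurable_section.
have -> : (fun a => tinj (section_act g s a)) =
    (fun a => tinj (phi g (s a))) \o act g^-1%g.
  by apply/funext => a; rewrite /= tinj_cast.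
by apply: borel_fun_comp; [exact: phi_measurable|exact: act_borel_fun].
Qed.

Lemma section_act_linear g k s t :
  section_act g (k *: s + t) = k *: section_act g s + section_act g t.
Proof.
apply: functional_extensionality_dep => a.
by rewrite /section_act tsectionDE tsectionZE phi_linear fiber_castP.
Qed.

Lemma section_act1 s : section_act 1%g s = s.
Proof.
apply: functional_extensionality_dep => a; apply: tinj_inj.
by rewrite tinj_cast phi1 invg1 act_group.1.
Qed.

Lemma section_actM g h s :
  section_act (g * h)%g s = section_act g (section_act h s).
Proof.
apply: functional_extensionality_dep => a; apply: tinj_inj.
by rewrite !tinj_cast phiM tinj_phi_cast invgM act_group.2.
Qed.

(** Linearity of [phi] splits the difference and equivariance moves each arrow; the cocycle identity
    rests on this. *)
Lemma section_act_arrow_diff g x y :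
  section_act g (arrow_diff B x y) = arrow_diff B (act g x) (act g y).
Proof.
apply: functional_extensionality_dep => a.
rewrite /section_act /arrow_diff addrC -scaleN1r phi_linear fiber_castP.
by rewrite !phi_arrow !fiber_cast_arrow scaleN1r addrC.
Qed.

(** * Linear isometries of [L^p] *)

Variable mu : {measure set (borel X) -> \bar R}.
Hypothesis act_mu : measure_preserving_action act mu.

(** As [phi] preserves norms, the integrand is only composed with [g^-1], which preserves [mu]. *)
Lemma section_Lnorm_act (p : R) g s : 0 < p -> measurable_section s ->
  section_Lnorm mu p (section_act g s) = section_Lnorm mu p s.
Proof.
move=> p0 ms; rewrite !section_LnormE//; congr (_ `^ _)%E.
under eq_integral do rewrite norm_section_act.
apply: (ge0_integral_measure_preserving (f := fun a => (`|s a| `^ p)%:E)).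
- exact: act_borel_fun.
- exact: act_mu.
- apply/measurable_EFinP; apply: (measurableT_comp (measurable_powR _)) => //.
  exact: measurable_section_norm.
- by move=> a; rewrite lee_fin powR_ge0.
Qed.

Variables (p : R) (p1 : 1 <= p).
Local Notation V := (Lp mu B p1).

Lemma section_act_Lp g (s : Lp_section mu B p1) :
  section_act g (Lp_val s) \in Lp_pred mu p1.
Proof.
have /asboolP[ms sy] := Lp_valP s.
apply/asboolP; split; first exact: measurable_section_act.
by rewrite section_Lnorm_act//; exact: lt_le_trans p1.
Qed.

Definition Lp_section_act g s := LpSection (section_act_Lp g s).

Lemma Lp_section_act_linear g k s t :
  Lp_section_act g (k *: s + t) = k *: Lp_section_act g s + Lp_section_act g t.
Proof. by apply: val_inj; exact: section_act_linear. Qed.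

Definition Lp_act g (x : V) : V := Lp_class (Lp_section_act g (repr x)).

Lemma norm_Lp_section_act g s :
  `|Lp_class (Lp_section_act g s)| = `|Lp_class s|.
Proof.
rewrite !Lp_normE section_Lnorm_act//; first exact: lt_le_trans p1.
exact: Lp_section_measurable.
Qed.

Lemma Lp_classB (s t : Lp_section mu B p1) :
  Lp_class (s - t) = Lp_class s - Lp_class t.
Proof. by rewrite Lp_classD -scaleN1r Lp_classZ scaleN1r. Qed.

(** Independence of the representative: by linearity the two images differ by the image of a null
    section, and norms are preserved. *)
Lemma Lp_act_class g s : Lp_act g (Lp_class s) = Lp_class (Lp_section_act g s).
Proof.
apply/eqP; rewrite -subr_eq0 -normr_eq0 -Lp_classB.
rewrite addrC -scaleN1r -Lp_section_act_linear norm_Lp_section_act.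
by rewrite Lp_classD Lp_classZ Lp_classK scaleN1r addNr normr0.
Qed.

Lemma Lp_act_is_linear g : linear (Lp_act g).
Proof.
move=> k x y; rewrite -[x]Lp_classK -[y]Lp_classK -Lp_classZ -Lp_classD.
by rewrite !Lp_act_class Lp_section_act_linear Lp_classD Lp_classZ.
Qed.

HB.instance Definition _ g :=
  GRing.isLinear.Build R V V *:%R (Lp_act g) (Lp_act_is_linear g).

Lemma Lp_act1 x : Lp_act 1%g x = x.
Proof.
rewrite -[x]Lp_classK Lp_act_class; congr Lp_class.
by apply: val_inj; exact: section_act1.
Qed.

Lemma Lp_actM g h x : Lp_act (g * h)%g x = Lp_act g (Lp_act h x).
Proof.
rewrite -[x]Lp_classK !Lp_act_class; congr Lp_class.
by apply: val_inj; exact: section_actM.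
Qed.

Lemma norm_Lp_act g x : `|Lp_act g x| = `|x|.
Proof. by rewrite -[x]Lp_classK Lp_act_class norm_Lp_section_act. Qed.

(** * The cocycle and the affine action *)

Variable x0 : X.
Hypothesis arrow_diff_in_Lp : forall x y, arrow_diff B x y \in Lp_pred mu p1.

Definition Lp_cocycle g : V :=
  Lp_class (LpSection (arrow_diff_in_Lp (act g x0) x0)).

(** Pushing the field of [h] by [g] gives the arrows to [g h x0] minus those to [g x0]; adding the
    field of [g] telescopes. *)
Lemma Lp_cocycleM g h :
  Lp_cocycle (g * h)%g = Lp_cocycle g + Lp_act g (Lp_cocycle h).
Proof.
rewrite /Lp_cocycle Lp_act_class -Lp_classD; congr Lp_class.
apply: val_inj => /=.
rewrite section_act_arrow_diff -act_group.2.
apply: functional_extensionality_dep => a.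
by rewrite tsectionDE /arrow_diff [RHS]addrC addrA subrK.
Qed.

Definition Lp_affine_action : affine_isometric_action G V :=
  AffineIsometricAction (linear_part := fun g => Lp_act g : {linear V -> V})
    Lp_act1 Lp_actM norm_Lp_act Lp_cocycleM.

End SectionAction.

(** * Properness of the affine action *)

Lemma proper_nonneg_function_cvgy (R : realType) (f : R -> R) (u : nat -> R) :
  proper_nonneg_function f -> (forall n, 0 <= u n) ->
  u n @[n --> \oo] --> +oo -> f (u n) @[n --> \oo] --> +oo.
Proof.
move=> [f0 f_proper] u0 uy; apply/cvgryPge => A.
have /f_proper : compact `[0, A] by exact: segment_compact.
rewrite precompactE => /compact_bounded[M [_ bndM]].
move/cvgryPgt: uy => /(_ (M + 1)); apply: filterS => n Mun.
rewrite leNgt; apply/negP => fA.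
(* [M] bounds the closure of the preimage of [[0, A]], so [f (u n) < A] would contradict
   [M + 1 < u n]. *)
have : closure ([set t | 0 <= t] `&` f @^-1` `[0, A]) (u n).
  by apply: subset_closure; split; rewrite /= ?u0// in_itv/= f0// ltW.
have M1 : M < M + 1 by rewrite ltrDl.
by move=> /(bndM _ M1) /=; rewrite ger0_norm// leNgt Mun.
Qed.

Lemma Lp_norm_ge (R : realType) (X : pmetricType R)
    (mu : {measure set (borel X) -> \bar R}) (B : tangent_bundle X)
    (p : R) (p1 : 1 <= p) (s : Lp_section mu B p1) (r : R) : 0 <= r ->
  ((r `^ p)%:E <= \int[mu]_a (`|Lp_val s a| `^ p)%:E)%E -> r <= `|Lp_class s|.
Proof.
have p0 : 0 < p by exact: (lt_le_trans ltr01 p1).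
move=> r0 rp.
have := Lp_section_finite s; rewrite Lp_normE section_LnormE// fine_poweR.
set I := (\int[mu]_a _)%E => Ip.
have I0 : (0 <= I)%E by apply: integral_ge0 => a _; rewrite lee_fin powR_ge0.
(* [fine] sends infinity to 0, so finiteness of [I] must first be recovered from that of its
   root. *)
have I_fin : I \is a fin_num.
  rewrite ge0_fin_numE//; apply: (@lty_poweRy _ _ p^-1).
    by rewrite gt_eqF ?invr_gt0.
  by rewrite -ge0_fin_numE ?poweR_ge0.
rewrite -[r in r <= _](powRr1 r0) -(mulfV (lt0r_neq0 p0)) powRrM.
apply: ge0_ler_powR; rewrite ?nnegrE ?powR_ge0 ?fine_ge0 ?invr_ge0//.
  exact: ltW.
by rewrite -lee_fin fineK.
Qed.

Theorem theorem2p2 (R : realType) (X : pmetricType R)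
    (mu : {measure set (borel X) -> \bar R})
    (X_locally_compact : locally_compact [set: X])
    (mu_radon : radon_measure mu)
    (h : R) (entropy : forall x : X, volume_entropy mu x = h%:E)
    (G : topologicalGroupType)
    (G_hausdorff : hausdorff_space G)
    (G_second_countable : @second_countable G)
    (G_locally_compact : locally_compact [set: G])
    (act : G -> X -> X)
    (act_group : group_action act)
    (act_isometric : isometric_action act)
    (act_measure_preserving : measure_preserving_action act mu)
    (TX : tangent_bundle X)
    (TX_equivariant : equivariant_tangent_bundle TX act)
    (kappa : R) (kappa_lt0 : kappa < 0)
    (TX_curvature : curvature_at_most TX kappa)
    (p : R) (p_gt1 : 1 < p) (p_gt : h / `|kappa| < p) :
  exists alpha : affine_isometric_action G (Lp mu TX (ltW p_gt1)),
    proper_tangent_bundle TX mu -> proper_action act ->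
    proper_affine_action alpha.
Proof.
have [phi [phi_iso phi_arrow phi1 phiM phi_meas]] := TX_equivariant.
have arrow_Lp x y :=
  arrow_diff_Lp (ltW p_gt1) y (entropy x) kappa_lt0 TX_curvature p_gt.
exists (Lp_affine_action act_group act_isometric phi_iso phi_arrow phi1 phiM
  phi_meas act_measure_preserving point arrow_Lp).
move=> [f f_proper f_le] act_proper u uy.
have fy := proper_nonneg_function_cvgy f_proper (fun n => mdist_ge0 _ _)
  (act_proper point u uy).
apply/cvgryPge => A.
(* Truncating [A] at 0 makes it the [p]-th root of the threshold imposed on [f]. *)
move/cvgryPge: fy => /(_ (Num.max A 0 `^ p)); apply: filterS => n An.
apply: (@le_trans _ _ (Num.max A 0)); first by rewrite le_max lexx.
apply: Lp_norm_ge; first by rewrite le_max lexx orbT.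
rewrite (le_trans _ (f_le _ _ _ p_gt1))// lee_fin metric_sym.
exact: An.
Qed.
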